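(* A connected finite undirected simple graph $G=(V,E)$ contains a parity Hamiltonian cycle if and only if $|V|$ is even or $G$ is non-bipartite.
   Context: A closed walk is a sequence $v_0e_1v_1\cdots e_\ell v_\ell$ with $e_i=\{v_{i-1},v_i\}\in E$ and $v_\ell=v_0$; vertices and edges may be repeated. The visit number of a vertex $v$ is the number of indices $i\in\{1,\dots,\ell\}$ with $v_i=v$. A parity Hamiltonian cycle is a closed walk in which every vertex of $G$ has odd visit number. *)

(* Defs.v *)
From mathcomp Require Import all_boot.

Set Implicit Arguments.
Unset Strict Implicit.
Unset Printing Implicit Defensive.

(* A finite simple graph is a symmetric irreflexive adjacency relation on a
   finType. The empty graph is not connected. *)
Definition connected_graph (V : finType) (E : rel V) : Prop :=
  0 < #|V| /\ forall x y : V, connect E x y.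

Definition bipartite (V : finType) (E : rel V) : Prop :=
  exists A : {set V}, forall x y : V, E x y -> (x \in A) != (y \in A).

(* The walk v_0 e_1 v_1 ... e_l v_l is given by v0 = v_0 and p = [v_1; ...; v_l]:
   in a simple graph, the edge e_i = {v_{i-1}, v_i} is determined by its
   endpoints. The length l may be 0. *)
Definition closed_walk (V : finType) (E : rel V) (v0 : V) (p : seq V) : Prop :=
  path E v0 p /\ last v0 p = v0.

(* Only the indices 1, ..., l are counted, so v_0 = v_l is not counted twice. *)
Definition visit_number (V : finType) (p : seq V) (v : V) : nat := count_mem v p.

Definition parity_hamiltonian_cycle (V : finType) (E : rel V) (v0 : V)
    (p : seq V) : Prop :=
  closed_walk E v0 p /\ forall v : V, odd (visit_number p v).

(* Main.v *)
Require Import Defs.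
From mathcomp Require Import all_boot.

Set Implicit Arguments.
Unset Strict Implicit.
Unset Printing Implicit Defensive.

(** A closed walk with odd visit numbers has length congruent to [#|V|] mod 2,
    and closed walks of a bipartite graph have even length. Conversely, going
    from [r] to [x] along any walk and back along the same walk is a closed walk
    that changes exactly the visit parities of [r] and [x] (none if [x = r]).
    Hence the visit parities of a closed walk at [r] can be changed on any set of
    even size, and a parity Hamiltonian cycle exists as soon as some closed walk
    at [r] has length congruent to [#|V|] mod 2: the empty walk when [#|V|] is
    even, an odd closed walk when the graph is not bipartite. *)

(** The length is the sum of the visit counts, and modulo 2 only the odd ones contribute. *)
Lemma odd_size_count (V : finType) (p : seq V) :
  odd (size p) = odd #|[pred v | odd (count_mem v p)]|.
Proof.
have -> : size p = \sum_(v : V) count_mem v p.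
  elim: p => [|x p IHp] /=; first by rewrite big1.
  rewrite big_split -IHp /= (bigD1 x) //= eqxx big1 // => v /negPf.
  by rewrite eq_sym => ->.
rewrite -sum1_card [in RHS]big_mkcond /= !(big_morph odd oddD (erefl (odd 0))).
by apply: eq_bigr => v _; rewrite inE; case: odd.
Qed.

Lemma bipartite_walk_parity (V : finType) (E : rel V) (A : {set V}) :
  (forall x y, E x y -> (x \in A) != (y \in A)) ->
  forall v p, path E v p -> (last v p \in A) = (v \in A) (+) odd (size p).
Proof.
move=> EA v p; elim: p v => [|w p IHp] v /=; first by rewrite addbF.
by case/andP=> /EA + /IHp ->; case: (v \in A); case: (w \in A); case: odd.
Qed.

Section SymmetricWalks.

Variables (V : finType) (E : rel V).
Hypothesis E_sym : symmetric E.

Lemma rev_walk r p : path E r p -> path E (last r p) (rev (belast r p)).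
Proof. by rewrite rev_path (eq_path (e' := E)). Qed.

Lemma last_rev_belast (r : V) p :
  last (last r p) (rev (belast r p)) = r.
Proof. by case: p => //= x p; rewrite rev_cons last_rcons. Qed.

Lemma back_and_forth_walk r p : path E r p ->
  closed_walk E r (p ++ rev (belast r p)).
Proof.
move=> rp; split; first by rewrite cat_path rp rev_walk.
by rewrite last_cat last_rev_belast.
Qed.

(** As [r :: p] is [rcons (belast r p) (last r p)], the way out and the way back have the same
    counts up to the two endpoints. *)
Lemma odd_count_back_and_forth (r : V) p v :
  odd (count_mem v (p ++ rev (belast r p))) = (r == v) (+) (last r p == v).
Proof.
have /(congr1 (odd \o count_mem v)) /= := lastI r p.
rewrite count_cat count_rev -cats1 count_cat /= addn0 !oddD !oddb.
by case: (r == v); case: (last r p == v); do 2!case: odd.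
Qed.

Hypothesis E_conn : forall x y, connect E x y.

(** Each entry [x] of [s] appends a round trip from [r] to [x], so [r] is flipped once per entry. *)
Lemma closed_walk_flip_parities r p s : closed_walk E r p ->
  exists2 q, closed_walk E r q &
    forall v, odd (count_mem v q) =
      odd (count_mem v p) (+) odd (count_mem v s) (+) (odd (size s) && (r == v)).
Proof.
move=> rp; elim: s => [|x s [q [rq lq] qE]] /=.
  by exists p => // v; rewrite !addbF.
have /connectP [w rw lw] := E_conn r x.
have [rb lb] := back_and_forth_walk rw.
exists (q ++ (w ++ rev (belast r w))).
  by split; [rewrite cat_path rq lq | rewrite last_cat lq].
move=> v; rewrite count_cat oddD qE odd_count_back_and_forth -lw oddD oddb.
by case: (r == v); case: (x == v); do 3!case: odd.
Qed.

Lemma parity_hamiltonian_cycle_of_length r p : closed_walk E r p ->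
  odd (size p) = odd #|V| -> exists q, parity_hamiltonian_cycle E r q.
Proof.
move=> rp; rewrite odd_size_count; set O := [pred v | _] => oddO.
(* Flip the vertices of even visit number; by [oddO] there are evenly many, so [r] gets no extra
   flip. *)
have [q rq qE] := closed_walk_flip_parities (enum [predC O]) rp.
exists q; split=> // v; rewrite /visit_number qE -cardE.
have -> : odd #|[predC O]| = false.
  by move: oddO; rewrite -(cardC O) oddD; do 2!case: odd.
rewrite (count_uniq_mem _ (enum_uniq _)) mem_enum !inE oddb.
by case: odd.
Qed.

(** Fix a walk from [r] to each vertex. If the walks to the ends of some edge have lengths of equal
    parity, they close up with this edge to an odd walk; otherwise the length parity is a
    2-colouring. *)
Lemma odd_closed_walk r : ~ bipartite E ->
  exists2 p, closed_walk E r p & odd (size p).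
Proof.
move=> nbip.
have walk x : {s | path E r s & last r s == x}.
  by apply: sig2W; have /connectP [s rs ->] := E_conn r x; exists s.
pose f x := s2val (walk x).
have rf x : path E r (f x) by rewrite /f; case: (walk x).
have lf x : last r (f x) = x by rewrite /f; case: (walk x) => s _ /= /eqP.
have [/existsP [x /existsP [y /andP [Exy fxy]]] | bip] :=
    boolP [exists x, exists y, E x y && (odd (size (f x)) == odd (size (f y)))].
  exists (f x ++ y :: rev (belast r (f y))).
    have := rev_walk (rf y); have := last_rev_belast r (f y).
    by rewrite /closed_walk cat_path last_cat /= rf !lf Exy => -> ->.
  by rewrite size_cat /= size_rev size_belast addnS /= oddD (eqP fxy) addbb.
case: nbip; exists [set x | odd (size (f x))] => x y Exy; rewrite !inE.
move: bip; rewrite negb_exists => /forallP/(_ x).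
by rewrite negb_exists => /forallP/(_ y); rewrite Exy.
Qed.

End SymmetricWalks.

Theorem theorem3p1 (V : finType) (E : rel V)
    (E_sym : symmetric E) (E_irrefl : irreflexive E)
    (E_conn : connected_graph E) :
  (exists (v0 : V) (p : seq V), parity_hamiltonian_cycle E v0 p) <->
  (~~ odd #|V| \/ ~ bipartite E).
Proof.
case: E_conn => /card_gt0P [r _] conn; split.
  move=> [v0 [p [[v0p lp] oddp]]].
  have [oddV | evenV] := boolP (odd #|V|); [right | by left].
  move=> [A EA]; have := bipartite_walk_parity EA v0p.
  (* All visit numbers are odd, so the length is odd like [#|V|], and the walk would end on the
     other side of [A]. *)
  rewrite lp odd_size_count (eq_card (B := V)) ?oddV; first by case: (_ \in A).
  by move=> v; rewrite !inE; apply: oddp.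
move=> H; exists r.
have [oddV | evenV] := boolP (odd #|V|).
  have [p rp oddp] : exists2 p, closed_walk E r p & odd (size p).
    by apply: odd_closed_walk => //; case: H => //; rewrite oddV.
  by apply: (parity_hamiltonian_cycle_of_length E_sym conn rp); rewrite oddp oddV.
apply: (parity_hamiltonian_cycle_of_length E_sym conn (p := [::])) => //.
by rewrite (negPf evenV).
Qed.
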